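(* If $n$ is a positive integer with $n\leq 10^{14}$ and $\phi(n)=\frac{2}{3}(n+1)$, where $\phi$ is Euler's totient function, then $n\in\{5,\ 35,\ 1295,\ 1679615\}$.
   Context: Here $35=5\cdot7$, $1295=5\cdot7\cdot37$, $1679615=5\cdot7\cdot37\cdot1297$ are the previously known solutions. *)

(* Defs.v *)
From mathcomp Require Import all_boot all_order all_algebra.

Set Implicit Arguments.
Unset Strict Implicit.
Unset Printing Implicit Defensive.

(* Main.v *)
Require Import Defs.
From Stdlib Require Import NArith ZArith MSetPositive Lia.
From mathcomp Require Import all_boot all_order all_algebra.
From mathcomp Require Import zify.
Import GRing.Theory.

(**
  Write the equation as 3 phi(n) = 2 (n + 1).  Bounding phi(n) / n shows that n is prime
  to 6; a prime p dividing both n and phi(n) would divide 2 (n + 1) and n, hence 2.  So n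
  is a product of distinct primes >= 5, none of them congruent to 1 modulo another.

  These products are enumerated by increasing prime factors.  If m is the product of the
  primes already chosen and A = 3 phi(m), the remaining primes p_1 < ... < p_k satisfy
    A (p_1 - 1) ... (p_k - 1) = 2 m p_1 ... p_k + 2,
  so that d = A - 2 m is positive and A < d p_1 <= k A.  For k = 1 the prime is determined:
  d p_1 = A + 2.  For k = 2 and A = 2 g, the product x = p_1 p_2 satisfies
    (g - m) x = g (p_1 + p_2 - 1) + 1,
  so x lies in a fixed residue class modulo g, and g is large; each x gives p_1 + p_2, and
  then p_1 and p_2.  With the bound 10^14 this leaves about 10^5 cases, which are checked
  by evaluation in binary arithmetic.
*)

(** * The search as an executable function *)

Local Open Scope N_scope.

(** With bound 16384 = 128^2 and 63 values of [q], from 3 to 127, this lists every odd composite up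
    to the bound. *)
Definition odd_products (bound : N) (k : nat) : seq N :=
  flatten [seq
    [seq q * (q + 2 * N.of_nat i) | i <- iota 0 (N.to_nat ((bound / q - q) / 2 + 1))]
    | q <- [seq 3 + 2 * N.of_nat j | j <- iota 0 k]].

Definition positive_set (s : seq N) : PositiveSet.t :=
  foldr (fun n => if n is Npos p then PositiveSet.add p else id) PositiveSet.empty s.

(* The factor 98801 is out of reach of the sieve; [17 * 98801 = 1679615 + 2] must be
   recognized as composite because [n = 1679615 * (1679615 + 2)], which is below [10 ^ 14],
   would be a solution if it were prime. *)
Definition composites : PositiveSet.t :=
  positive_set (17 * 98801 :: odd_products 16384 63).

(** Only a necessary condition for primality: a composite beyond the sieve may pass and merely adds
    a case to check. *)
Definition allowed (fs : seq N) (p : N) : bool :=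
  if p is Npos p' then
    if PositiveSet.mem p' composites then false
    else ~~ has (fun q => N.eqb ((p - 1) mod q) 0) fs
  else false.

(* The default value encodes that all primes considered are at least 5. *)
Definition last_prime (fs : seq N) : N := head 4 fs.

Definition solutions : seq N := [:: 5; 35; 1295; 1679615].

Fixpoint scan (f : N -> bool) (k : nat) (step p : N) : bool :=
  if k is k'.+1 then if f p then scan f k' step (p + step) else false else true.

(* Extended Euclid; its output is not proved correct, but checked in [search_pair]. *)
Fixpoint bezout (k : nat) (a b u v : Z) : Z :=
  if k is k'.+1 then
    let (q, r) := Z.div_eucl a b in
    if r is Z0 then v else bezout k' b r v (Z.sub u (Z.mul q v))
  else v.

Definition inverse (e g : N) : N :=
  Z.to_N (bezout 100 (Z.of_N g) (Z.of_N e) 0 1 mod Z.of_N g).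

Definition search_last (B m A : N) (fs : seq N) : bool :=
  let d := A - 2 * m in
  if N.ltb (B * d) (A + 2) then true else
  let p := (A + 2) / d in
  if N.eqb (d * p) (A + 2) then
    if N.leb p (last_prime fs) then true else
    if allowed fs p then m * p \in solutions else true
  else true.

(** Here [c] is the residue of x modulo [g], [s] is the sum of the two primes, and [p] is the
    smaller root of t^2 - s t + x. A wrong inverse makes the check fail. *)
Definition search_pair (B m A : N) (fs : seq N) : bool :=
  let g := N.div2 A in
  let e := g - m in
  let c := inverse e g in
  if N.eqb ((e * c) mod g) 1 then
    scan (fun x =>
      let s := e * x / g + 1 in
      let p := (s - N.sqrt (s * s - 4 * x)) / 2 in
      let q := s - p in
      if N.eqb (p * q) x then
        if N.leb p (last_prime fs) then true else
        if allowed fs p then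
          if allowed (p :: fs) q then m * x \in solutions else true
        else true
      else true) (N.to_nat (B / g + 1)) g c
  else false.

(* [fs] lists the primes chosen so far, the largest first, [m] is their product and
   [A = 3 * phi m]; it remains to choose [r.+1] primes with product at most [B].  When two
   primes remain, the cheaper of the two enumerations is selected. *)
Fixpoint search (r : nat) (B m A : N) (fs : seq N) : bool :=
  if r is r'.+1 then
    let d := A - 2 * m in
    let p0 := N.max (last_prime fs + 1) (A / d + 1) in
    let lo := N.succ_double (N.div2 p0) in
    let hi := N.min (N.of_nat r.+1 * A / d) (N.sqrt (B / p0 ^ N.of_nat r')) in
    if N.ltb hi lo then true else
    if (if r' is O then
          if N.even A then N.ltb (B / A) ((hi - lo) / 4) else false
        else false)
    then search_pair B m A fs
    else scan (fun p =>
        if allowed fs p then search r' (B / p) (m * p) (A * (p - 1)) (p :: fs)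
        else true) (N.to_nat ((hi + 2 - lo) / 2)) 2 lo
  else search_last B m A fs.

(** * Bounds for products of p and of p - 1 *)

Definition prodN (ps : seq N) : N := foldr N.mul 1 ps.
Definition totN (ps : seq N) : N := foldr (fun p => N.mul (p - 1)) 1 ps.

Fixpoint admissible (fs ps : seq N) : Prop :=
  if ps is p :: ps' then
    [/\ last_prime fs < p, N.odd p, allowed fs p & admissible (p :: fs) ps']
  else True.

Lemma scanP f k step p i :
  scan f k step p -> i < N.of_nat k -> f (p + i * step).
Proof.
elim: k p i => [|k IH] p i /=; first lia.
case fp: (f p) => // sc lt_ik.
have [->|nz] := N.eq_dec i 0; first by rewrite N.mul_0_l N.add_0_r.
have -> : p + i * step = p + step + (i - 1) * step by nia.
by apply: IH => //; lia.
Qed.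

Lemma totN_le ps : totN ps <= prodN ps.
Proof. elim: ps => //= p ps IH; nia. Qed.

Lemma admissible_ge fs ps : admissible fs ps -> all (N.leb (last_prime fs + 1)) ps.
Proof.
elim: ps fs => //= p ps IH fs [lt_p _ _ /IH/= le_ps].
apply/andP; split; first by apply/N.leb_spec0; lia.
apply: sub_all le_ps => x /N.leb_spec0 => le_x; apply/N.leb_spec0.
by rewrite /last_prime/= in le_x lt_p *; lia.
Qed.

Lemma prodN_ge p ps : all (N.leb p) ps -> p ^ N.of_nat (size ps) <= prodN ps.
Proof.
elim: ps => [|q ps IH] // /andP[/N.leb_spec0 le_pq /IH le_ps].
rewrite [size _]/= [prodN _]/= Nat2N.inj_succ N.pow_succ_r'; nia.
Qed.

(* Bernoulli's inequality for the product of the [1 - 1 / p_i], denominators cleared. *)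
Lemma totN_ge p ps : all (N.leb p) ps ->
  p * prodN ps <= p * totN ps + N.of_nat (size ps) * prodN ps.
Proof.
elim: ps => [|q ps IH]; first by rewrite /=; lia.
case/andP=> [/N.leb_spec0 le_pq /IH le_ps].
have := totN_le ps; move: le_ps.
rewrite [size (_ :: _)]/= [prodN (_ :: _)]/= [totN (_ :: _)]/= Nat2N.inj_succ.
move: (totN ps) (prodN ps) (N.of_nat _) => X Y k IHk le_XY.
have [q0|q_gt0] := N.eq_dec q 0; first by rewrite q0 !N.mul_0_l N.mul_0_r; apply: N.le_0_l.
have [q' defq] : exists q', q = q' + 1 by exists (q - 1); lia.
rewrite defq N.add_sub in le_pq *.
have : p * X <= (q' + 1) * Y by apply: N.mul_le_mono; lia.
nia.
Qed.

(** * Soundness of the search *)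

Lemma search_last_sound B m A fs p :
    search_last B m A fs -> admissible fs [:: p] -> p <= B -> 0 < m ->
    A * (p - 1) = 2 * m * p + 2 ->
  m * p \in solutions.
Proof.
move=> + [lt_p _ al_p _] le_pB m_gt0 eqA; rewrite /search_last.
have p_gt0 : 0 < p by lia.
have lt_mA : 2 * m < A by nia.
have [d [d_gt0 defA]] : exists d, 0 < d /\ A = 2 * m + d by exists (A - 2 * m); lia.
have -> : A - 2 * m = d by lia.
have eqd : d * p = A + 2.
  have [p' defp] : exists p', p = p' + 1 by exists (p - 1); lia.
  by move: eqA; rewrite defp N.add_sub defA; nia.
have -> : (A + 2) / d = p by rewrite -eqd N.mul_comm N.div_mul //; lia.
rewrite eqd N.eqb_refl al_p.
case: N.ltb_spec; first by nia.
by case: N.leb_spec => //; lia.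
Qed.

Lemma inverse_lt e g : 0 < g -> inverse e g < g.
Proof.
move=> g_gt0; rewrite /inverse; move: (bezout _ _ _ _ _) => z.
by have := Z.mod_pos_bound z (Z.of_N g); lia.
Qed.

(** Stated with a = p - 1 and b = q - 1 to avoid truncated differences; it rests on a b = (a + 1) (b
    + 1) - (a + b + 1). *)
Lemma pair_identity g m a b :
    g * (a * b) = m * ((a + 1) * (b + 1)) + 1 ->
  m < g /\ (g - m) * ((a + 1) * (b + 1)) = g * (a + b + 1) + 1.
Proof.
move=> eqg; have lt_mg : m < g.
  apply/N.nle_gt => le_gm.
  have : g * (a * b) <= m * ((a + 1) * (b + 1)).
    by apply: N.mul_le_mono => //; nia.
  lia.
have [d defg] : exists d, g = m + d by exists (g - m); lia.
split=> //; have -> : g - m = d by lia.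
by move: eqg; rewrite defg; lia.
Qed.

Lemma search_pair_sound B m A fs p q :
    search_pair B m A fs -> N.even A -> admissible fs [:: p; q] -> p * q <= B ->
    0 < m -> A * ((p - 1) * (q - 1)) = 2 * m * (p * q) + 2 ->
  m * (p * q) \in solutions.
Proof.
move=> + A_even [lt_p _ al_p [lt_q _ al_q _]] le_B m_gt0 eqA.
rewrite /search_pair {1}/last_prime/= in lt_q *.
set g := N.div2 A; set e := g - m; set c := inverse e g.
have defA : A = 2 * g.
  by rewrite /g; case: (A) A_even => [|[a|a|]] //=; lia.
have [a [b [defp defq]]] : exists a b, p = a + 1 /\ q = b + 1.
  by exists (p - 1), (q - 1); lia.
have eqg : g * (a * b) = m * ((a + 1) * (b + 1)) + 1.
  by move: eqA; rewrite defA defp defq !N.add_sub; lia.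
have [lt_mg] := pair_identity _ _ _ _ eqg; rewrite -/e => eqe.
have {}eqe : e * (p * q) = g * (p + q - 1) + 1.
  by rewrite defp defq eqe; congr (g * _ + 1); lia.
case: N.eqb_spec => // inv_c sc.
(* Multiply p q by e c, which is 1 modulo g, and use that e p q is 1 modulo g. *)
have modx : (p * q) mod g = c.
  rewrite -(N.mod_small c g); last by apply: inverse_lt; lia.
  have g0 : g <> 0 by lia.
  rewrite -[p * q in LHS]N.mul_1_r -{1}inv_c N.Div0.mul_mod_idemp_r.
  have -> : p * q * (e * c) = c * (e * (p * q)) by lia.
  rewrite -N.Div0.mul_mod_idemp_r eqe.
  by rewrite (N.add_comm (g * _)) (N.mul_comm g) N.Div0.mod_add N.mod_1_l ?N.mul_1_r //; lia.
have defx : p * q = c + (p * q) / g * g.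
  by rewrite -modx {1}(N.div_mod' (p * q) g); lia.
have lt_x : (p * q) / g < N.of_nat (N.to_nat (B / g + 1)).
  rewrite N2Nat.id; suff: p * q / g <= B / g by lia.
  by apply: N.Div0.div_le_mono.
have := scanP _ _ _ _ _ sc lt_x; rewrite -defx /=.
have -> : e * (p * q) / g + 1 = p + q.
  by rewrite eqe -(N.div_unique (g * (p + q - 1) + 1) g (p + q - 1) 1); lia.
(* The discriminant is a perfect square, so the integer square root is exact. *)
have -> : (p + q) * (p + q) - 4 * (p * q) = (q - p) * (q - p).
  have [k ->] : exists k, q = p + k by exists (q - p); lia.
  have -> : p + k - p = k by lia.
  lia.
rewrite N.sqrt_square.
have -> : p + q - (q - p) = p * 2 by lia.
rewrite N.div_mul //; have -> : p + q - p = q by lia.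
rewrite N.eqb_refl al_p al_q.
by case: N.leb_spec => //; lia.
Qed.

Lemma search_sound r B m A fs ps :
    search r B m A fs -> size ps = r.+1 -> admissible fs ps -> 4 <= last_prime fs ->
    prodN ps <= B -> 0 < m -> A * totN ps = 2 * m * prodN ps + 2 ->
  m * prodN ps \in solutions.
Proof.
elim: r B m A fs ps => [|r IH] B m A fs [//|p ps].
  case: ps => //= sch _ adm _; rewrite !N.mul_1_r => le_B m_gt0 eqA.
  exact: (search_last_sound B m A fs p).
move=> sch [size_ps] adm ge4 le_B m_gt0 eqA.
have [lt_p odd_p al_p adm_ps] := adm.
have ge_p : all (N.leb p) (p :: ps).
  rewrite /= N.leb_refl /=; apply: sub_all (admissible_ge _ _ adm_ps) => x.
  by move=> /N.leb_spec0 le_x; apply/N.leb_spec0; rewrite /last_prime /= in le_x; lia.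
have ps_ge : p + 1 <= prodN ps.
  move: size_ps (admissible_ge _ _ adm_ps) (prodN_ge (p + 1) ps) => -> ge_ps /(_ ge_ps).
  rewrite Nat2N.inj_succ N.pow_succ_r'.
  have : 0 < (p + 1) ^ N.of_nat r by apply: N.lt_lt_0 (_ : 0 < _); apply/N.neq_0_lt_0/N.pow_nonzero; lia.
  nia.
have le_tot := totN_le ps.
have [p' defp] : exists p', p = p' + 1 by exists (p - 1); lia.
have lt_A : 2 * m * p < A * (p - 1).
  move: eqA => /=; nia.
have [d [d_gt0 defA]] : exists d, 0 < d /\ A = 2 * m + d by exists (A - 2 * m); nia.
have lt_Ad : A < d * p by rewrite defp N.add_sub in lt_A *; nia.
(* With Y the product of all remaining primes, Bernoulli gives d p Y <= 2 p + (r + 2) A Y; since 2 p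
   < Y, the term 2 p is lost on dividing by Y. *)
have le_dp : d * p <= N.of_nat r.+2 * A.
  have := totN_ge _ _ ge_p; rewrite [size _]/= size_ps.
  have : 2 * p < prodN (p :: ps).
    by rewrite [prodN _]/= N.mul_comm; apply: (proj1 (N.mul_lt_mono_pos_l _ _ _ _)); lia.
  move: eqA; move: (totN _) (prodN _) (N.of_nat _) => X Y R eqA lt_Y le_R.
  have : A * (p * Y) <= p * (2 * m * Y + 2) + R * A * Y by rewrite -eqA; nia.
  rewrite defA; nia.
have := sch; cbn [search].
have -> : A - 2 * m = d by lia.
set p0 := N.max _ _; set lo := N.succ_double _; set hi := N.min _ _.
have le_p0 : p0 <= p.
  suff: A / d < p by rewrite /p0; lia.
  by apply: N.div_lt_upper_bound => //; lia.
have p0_gt0 : p0 <> 0 by rewrite /p0; lia.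
have [k defk] : exists k, p = 2 * k + 1.
  by exists (N.div2 p); rewrite {1}(N.div2_odd p) odd_p.
have [j deflo] : exists j, lo = 2 * j + 1 by exists (N.div2 p0); rewrite /lo N.succ_double_spec.
have le_lo : lo <= p.
  rewrite /lo N.succ_double_spec N.div2_div defk.
  have : p0 / 2 < k + 1 by apply: N.div_lt_upper_bound; lia.
  lia.
have le_hi : p <= hi.
  apply: N.min_glb; first by rewrite 1?N.mul_comm; apply: N.div_le_lower_bound; lia.
  (* Using only p^2 p0^r <= B bounds p by a square root instead of a root of order r + 2. *)
  apply/N.sqrt_le_square; apply: N.div_le_lower_bound; first exact: N.pow_nonzero.
  apply: N.le_trans le_B; apply: N.le_trans (prodN_ge _ _ ge_p).
  rewrite [size _]/= size_ps !Nat2N.inj_succ !N.pow_succ_r'.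
  rewrite [p * (p * _)]N.mul_assoc [p * p * _]N.mul_comm.
  by apply: N.mul_le_mono_r; apply: N.pow_le_mono_l.
case: N.ltb_spec; first by lia.
move=> _; case: ifP => [pair_case sc|_ sc].
  have [r0 evenA] : r = 0%nat /\ N.even A by case: (r) pair_case; case: (N.even A).
  have [q defps] : exists q, ps = [:: q].
    by case: (ps) size_ps => [|q [|? ?]]; rewrite r0 //; exists q.
  rewrite defps /= !N.mul_1_r in adm le_B eqA *.
  exact: (search_pair_sound B m A fs p q).
(* As [lo] and [p] are odd, steps of 2 reach [p]; the count is that of the odd numbers from [lo] to
   [hi]. *)
have lt_kj : k - j < N.of_nat (N.to_nat ((hi + 2 - lo) / 2)).
  rewrite N2Nat.id; have : k - j + 1 <= (hi + 2 - lo) / 2; last by lia.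
  by apply: N.div_le_lower_bound; lia.
have := scanP _ _ _ _ _ sc lt_kj.
have -> : lo + (k - j) * 2 = p by lia.
rewrite al_p => /IH/(_ size_ps adm_ps).
have -> : m * prodN (p :: ps) = m * p * prodN ps by rewrite /=; lia.
apply; rewrite ?[last_prime _]/=; first by lia.
- by apply: N.div_le_lower_bound; [lia | exact: le_B].
- by apply: N.mul_pos_pos; lia.
- move: eqA; rewrite [totN _]/= [prodN _]/=; lia.
Qed.

(** * Primes pass the sieve *)

Lemma mem_positive_set p s : PositiveSet.mem p (positive_set s) -> Npos p \in s.
Proof.
elim: s => [|[|q] s IH] //; rewrite in_cons.
by case/PositiveSet.add_spec => [->|/IH ->]; rewrite ?eqxx ?orbT.
Qed.

Lemma odd_productsP bound k n :
  n \in odd_products bound k -> exists a b, [/\ 1 < a, 1 < b & n = a * b].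
Proof.
case/flatten_mapP => _ /mapP[j _ ->] /mapP[i _ ->].
by exists (3 + 2 * N.of_nat j), (3 + 2 * N.of_nat j + 2 * N.of_nat i); split=> //; lia.
Qed.

Lemma compositesP p : PositiveSet.mem p composites ->
  exists a b, [/\ 1 < a, 1 < b & Npos p = a * b].
Proof.
rewrite /composites; move: (odd_productsP 16384 63).
move: (odd_products _ _) => s sP /mem_positive_set.
by rewrite in_cons => /predU1P[->|/sP //]; exists 17, 98801.
Qed.

Local Close Scope N_scope.

Lemma prime_allowed (p : nat) (gs : seq nat) :
    prime p -> all prime gs -> (forall q, q \in gs -> ~~ (q %| p.-1)) ->
  allowed [seq N.of_nat q | q <- gs] (N.of_nat p).
Proof.
move=> p_pr gs_pr p_gs; have p_gt1 := prime_gt1 p_pr.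
rewrite /allowed; case Np: (N.of_nat p) => [|p']; first by lia.
case: ifP => [/compositesP[a [b [a_gt1 b_gt1 def_p]]]|_].
  have {def_p} def_p : p = N.to_nat a * N.to_nat b.
    by rewrite -multE -N2Nat.inj_mul -def_p -Np Nat2N.id.
  case/primeP: p_pr => _ /(_ (N.to_nat a)); rewrite def_p dvdn_mulr // => /(_ isT).
  case/orP => /eqP; first by lia.
  by rewrite -multE; nia.
rewrite -Np; apply/hasPn => _ /mapP[q q_gs ->].
apply/negP => /N.eqb_spec /N.Lcm0.mod_divide [k def_k].
case/negP: (p_gs q q_gs); apply/dvdnP; exists (N.to_nat k).
rewrite -multE; lia.
Qed.

Lemma admissible_primes (n : nat) (gs ps : seq nat) :
    (forall p q, p \in primes n -> q \in primes n -> ~~ (q %| p.-1)) -> ~~ (2 %| n) ->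
    {subset gs <= primes n} -> {subset ps <= primes n} -> path ltn (head 4 gs) ps ->
  admissible [seq N.of_nat q | q <- gs] [seq N.of_nat p | p <- ps].
Proof.
move=> nmod n_odd; elim: ps gs => //= p ps IH gs sub_gs sub_ps /andP[lt_p path_ps].
have p_n : p \in primes n by apply: sub_ps; apply: mem_head.
have [p_pr _ dvd_p] : [/\ prime p, 0 < n & p %| n] by apply/and3P; rewrite -mem_primes.
split.
- by rewrite /last_prime; case: (gs) lt_p => [|q qs] /=; lia.
- have : ~~ (2 %| p) by apply: contra n_odd => /dvdn_trans; apply.
  rewrite dvdn2 negbK => odd_p.
  have -> : N.of_nat p = N.add (N.mul 2 (N.of_nat p./2)) 1 by lia.
  exact: N.odd_odd.
- apply: prime_allowed => //; last by move=> q /sub_gs; apply: nmod.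
  by apply/allP=> q /sub_gs; rewrite mem_primes => /and3P[].
- apply: (IH (p :: gs)) => // q; last by move=> q_ps; apply: sub_ps; rewrite in_cons q_ps orbT.
  by rewrite in_cons => /orP[/eqP -> //|/sub_gs].
Qed.

(** * Totients and prime divisors *)

Lemma totient_leq (n : nat) : totient n <= n.
Proof.
rewrite totient_count_coprime big_mkord -[leqRHS]card_ord -sum1_card.
by apply: leq_sum => i _; apply: leq_b1.
Qed.

Lemma totient_pfactor_dvd (p n : nat) : prime p -> p %| n -> 0 < n ->
  exists2 m, n = m * p ^ logn p n & totient n = totient m * (p.-1 * p ^ (logn p n).-1).
Proof.
move=> p_pr p_n n_gt0; have [m co_pm def_n] := pfactor_coprime p_pr n_gt0.
exists m => //; rewrite {1}def_n totient_coprime 1?coprime_sym ?coprimeXl //.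
by rewrite totient_pfactor // logn_gt0 mem_primes p_pr n_gt0.
Qed.

(** The cofactor m of the p-part of n contributes at most m to the totient. *)
Lemma leq_totient_prime (p n : nat) : prime p -> p %| n -> 0 < n ->
  p * totient n <= p.-1 * n.
Proof.
move=> p_pr p_n n_gt0; have [m def_n ->] := totient_pfactor_dvd _ _ p_pr p_n n_gt0.
have e_gt0 : 0 < logn p n by rewrite logn_gt0 mem_primes p_pr n_gt0.
rewrite {2}def_n -{2}(prednK e_gt0) expnS.
have -> u : p * (totient m * (p.-1 * u)) = p.-1 * (totient m * (p * u)) by lia.
by rewrite !leq_mul // totient_leq.
Qed.

(** * Transfer to binary numbers and evaluation *)

Lemma prodN_of_nat (ps : seq nat) :
  prodN [seq N.of_nat p | p <- ps] = N.of_nat (\prod_(p <- ps) p).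
Proof. by elim: ps => [|p ps IH]; rewrite ?big_nil //= big_cons IH; lia. Qed.

Lemma totN_of_nat (ps : seq nat) :
  totN [seq N.of_nat p | p <- ps] = N.of_nat (\prod_(p <- ps) p.-1).
Proof. by elim: ps => [|p ps IH]; rewrite ?big_nil //= big_cons IH; lia. Qed.

Lemma N_of_nat_expn (m k : nat) : N.of_nat (m ^ k) = N.pow (N.of_nat m) (N.of_nat k).
Proof. by elim: k => // k IH; rewrite expnS Nat2N.inj_succ N.pow_succ_r' -IH; lia. Qed.

(** Index [r] stands for r + 1 prime factors, starting from m = 1 and 3 phi(1) = 3; at most 20
    factors occur, as 5^21 > 10^14. *)
Lemma search_all : all (fun r => search r (N.pow 10 14) 1 3 [::]) (iota 0 20).
Proof. by vm_compute. Qed.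

(** * Arithmetic of a solution *)

Section Equation.

Variable n : nat.
Hypotheses (n_gt0 : 0 < n) (phi_n : 3 * totient n = 2 * (n + 1)).

Lemma not_dvdn2 : ~~ (2 %| n).
Proof. by apply/negP => /(leq_totient_prime 2 n isT)/(_ n_gt0); lia. Qed.

Lemma not_dvdn3 : ~~ (3 %| n).
Proof. by apply/negP => /(leq_totient_prime 3 n isT)/(_ n_gt0); lia. Qed.

Lemma prime_not_dvd_totient p : prime p -> p %| n -> ~~ (p %| totient n).
Proof.
move=> p_pr p_n; apply/negP => p_tot; case/negP: not_dvdn2.
have : p %| 2 * (n + 1) by rewrite -phi_n dvdn_mull.
by rewrite mulnDr muln1 dvdn_addr ?dvdn_mull // dvdn_prime2 // => /eqP <-.
Qed.

(** If p^2 divided n, then p would divide phi(n). *)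
Lemma logn_primes p : p \in primes n -> logn p n = 1.
Proof.
rewrite mem_primes => /and3P[p_pr _ p_n].
have [m _ def_tot] := totient_pfactor_dvd _ _ p_pr p_n n_gt0.
have e_gt0 : 0 < logn p n by rewrite logn_gt0 mem_primes p_pr n_gt0.
have := prime_not_dvd_totient _ p_pr p_n; rewrite def_tot.
case: (logn p n) e_gt0 => [|[|e]] // _ /=.
by rewrite expnS dvdn_mull // dvdn_mull // dvdn_mulr.
Qed.

(** Since p - 1 divides phi(n), so would q. *)
Lemma not_dvdn_pred p q : p \in primes n -> q \in primes n -> ~~ (q %| p.-1).
Proof.
rewrite !mem_primes => /and3P[p_pr _ p_n] /and3P[q_pr _ q_n].
have [m _ def_tot] := totient_pfactor_dvd _ _ p_pr p_n n_gt0.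
have := prime_not_dvd_totient _ q_pr q_n; rewrite def_tot.
by apply: contra => q_p; rewrite dvdn_mull // dvdn_mulr.
Qed.

Lemma prod_primes : n = \prod_(p <- primes n) p.
Proof.
rewrite {1}(prod_prime_decomp n_gt0) prime_decompE big_map /=.
by apply: eq_big_seq => p /logn_primes ->; rewrite expn1.
Qed.

Lemma totient_primes : totient n = \prod_(p <- primes n) p.-1.
Proof.
rewrite totientE //; apply: eq_big_seq => p /logn_primes ->.
by rewrite expn0 muln1.
Qed.

Lemma primes_gt4 : all (ltn 4) (primes n).
Proof.
apply/allP => p; rewrite mem_primes => /and3P[p_pr _ p_n].
have := not_dvdn2; have := not_dvdn3.
by case: p p_pr p_n => [|[|[|[|[|p]]]]] // _ ->.
Qed.

Lemma solution_in : n <= 10 ^ 14 -> N.of_nat n \in solutions.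
Proof.
move=> le_n.
have adm : admissible [::] [seq N.of_nat p | p <- primes n].
  apply: (admissible_primes n [::]) => //; [exact: not_dvdn_pred|exact: not_dvdn2|].
  by rewrite /= path_sortedE ?primes_gt4 ?sorted_primes //; apply: ltn_trans.
have def_prod : prodN [seq N.of_nat p | p <- primes n] = N.of_nat n.
  by rewrite prodN_of_nat -prod_primes.
have def_tot : totN [seq N.of_nat p | p <- primes n] = N.of_nat (totient n).
  by rewrite totN_of_nat -totient_primes.
have le_nN : N.le (N.of_nat n) (N.pow 10 14).
  (* The power in [nat] must stay unevaluated, being far too large in unary. *)
  have -> : N.pow 10 14 = N.of_nat (10 ^ 14) by rewrite N_of_nat_expn.
  lia.
(* Without prime factors n = 1, and the equation would read 3 = 4. *)
have size_gt0 : 0 < size (primes n).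
  case def_ps: (primes n) def_prod def_tot => [|//] /= n1 t1; lia.
have size_le : size (primes n) <= 20.
  rewrite leqNgt; apply/negP => size_gt.
  have := prodN_ge 5 _ (admissible_ge _ _ adm); rewrite def_prod size_map => ge_n.
  have : N.le (N.pow 5 21) (N.pow 5 (N.of_nat (size (primes n)))).
    by apply: N.pow_le_mono_r => //; lia.
  have : N.lt (N.pow 10 14) (N.pow 5 21) by [].
  lia.
have /allP/(_ (size (primes n)).-1) := search_all.
rewrite mem_iota => /(_ ltac:(lia)) sch.
rewrite -def_prod -[prodN _]N.mul_1_l.
apply: search_sound sch _ adm _ _ _ _ => //.
- by rewrite size_map prednK.
- by rewrite def_prod.
- by rewrite def_prod def_tot; lia.
Qed.

End Equation.

(** * The equation over the rationals *)

Local Open Scope ring_scope.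

Theorem theorem13 (n : nat) (n_gt0 : (0 < n)%N) (n_le : (n <= 10 ^ 14)%N)
    (phi_n : (totient n)%:R = 2 / 3 * (n + 1)%:R :> rat) :
  n \in [:: 5; 35; 1295; 1679615]%N.
Proof.
have phi_nat : (3 * totient n = 2 * (n + 1))%N.
  apply/eqP; rewrite -(Num.Theory.eqr_nat rat) !natrM phi_n.
  by rewrite mulrA (mulrCA 3) divff // mulr1.
have := solution_in n n_gt0 phi_nat n_le; rewrite /solutions !inE.
case/or4P => /eqP def_n; apply/or4P.
- by constructor 1; apply/eqP; lia.
- by constructor 2; apply/eqP; lia.
- by constructor 3; apply/eqP; lia.
- constructor 4; apply/eqP.
  (* Parsed as [Nat.of_num_uint _]; must not be normalized to a unary numeral. *)
  rewrite /Nat.of_num_uint /Nat.of_uint; cbn [Nat.of_uint_acc].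
  by rewrite !PeanoNat.Nat.tail_mul_spec; lia.
Qed.
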